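(* Let $d>0$ be an integer, let $N\geq d$ be an integer, and let $c\geq 0$ and $m>0$ be integers. Then $$\operatorname{div}(n,d)=\operatorname{div}(c\cdot n,m)\quad\text{and}\quad \operatorname{rem}(n,d)=\operatorname{div}(\operatorname{rem}(c\cdot n,m)\cdot d,\,m)$$ hold for all integers $n\in[0,N]$ if and only if $$\frac1d\leq \frac cm<\left(1+\frac1N\right)\frac1d.$$
   Context: For a non-negative real $x$ and a positive real $y$, define $\operatorname{div}(x,y)=\lfloor x/y\rfloor$ and $\operatorname{rem}(x,y)=x-\lfloor x/y\rfloor\cdot y$, where $\lfloor\cdot\rfloor$ is the floor function. *)

(* Defs.v *)
From mathcomp Require Import all_boot all_order all_algebra.
From mathcomp Require Import reals.
Set Implicit Arguments.
Unset Strict Implicit.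
Unset Printing Implicit Defensive.
Import Order.TTheory GRing.Theory Num.Theory.
Local Open Scope ring_scope.

(* Meant for 0 <= x and 0 < y; outside that range they are total functions
   with no intended meaning. The quotient is returned as an [int]. *)
Definition divR (R : realType) (x y : R) : int := Num.floor (x / y).

Definition remR (R : realType) (x y : R) : R :=
  x - (Num.floor (x / y))%:~R * y.

(* Main.v *)
(* With [e = c * d - m] and [n = q * d + r], the number [s = c * n - q * m]
   satisfies [s * d = e * n + r * m]. Once [q] is the quotient of [c * n] by
   [m], the second equation at [n] therefore says [0 <= e * n < m]; conversely
   these bounds force [0 <= s < m], which is the first equation. Both sides of
   the equivalence amount to [0 <= e * N < m], the extreme case [n = N]. *)
Require Import Defs.
From mathcomp Require Import all_boot all_order all_algebra.
From mathcomp Require Import reals.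
From mathcomp Require Import zify ring.
Set Implicit Arguments.
Unset Strict Implicit.
Unset Printing Implicit Defensive.
Import Order.TTheory GRing.Theory Num.Theory.
Local Open Scope ring_scope.

(** Clearing the positive denominator shows that both quotients are pinned down by
    [q * b <= a < (q + 1) * b]. *)
Lemma divR_intE (R : realType) (a b : int) :
  0 < b -> divR (a%:~R : R) b%:~R = (a %/ b)%Z.
Proof.
move=> b0; apply: floor_def.
have bR : 0 < b%:~R :> R by rewrite ltr0z.
rewrite ler_pdivlMr // ltr_pdivrMr // -!intrM ler_int ltr_int.
by rewrite lez_floor ?gt_eqF //= ltz_ceil.
Qed.

Lemma remR_intE (R : realType) (a b : int) :
  0 < b -> remR (a%:~R : R) b%:~R = (a %% b)%Z%:~R.
Proof.
move=> b0; have := divR_intE R a b0; rewrite /divR /remR => ->.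
by rewrite -intrM -intrB /modz.
Qed.

Lemma divz_unique (a b q : int) :
  0 < b -> q * b <= a < (q + 1) * b -> (a %/ b)%Z = q.
Proof.
move=> b0 /andP[lo hi].
have -> : a = q * b + (a - q * b) by ring.
rewrite divzMDl ?gt_eqF // divz_small ?addr0 //.
by rewrite gtz0_abs //; lia.
Qed.

Lemma div_rem_approxP (d c m n : int) : 0 < d -> 0 < m ->
  (n %/ d)%Z = (c * n %/ m)%Z /\ (n %% d)%Z = ((c * n %% m)%Z * d %/ m)%Z
  <-> 0 <= (c * d - m) * n < m.
Proof.
move=> d0 m0.
have nE := divz_eq n d; set q := (n %/ d)%Z in nE *.
set r := (n %% d)%Z in nE *.
have r0 : 0 <= r by rewrite modz_ge0 ?gt_eqF.
have rd : r < d by rewrite ltz_pmod.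
have sE : (c * n - q * m) * d = (c * d - m) * n + r * m by rewrite nE; ring.
split=> [[qE rE]|/andP[lo hi]].
  have lo := lez_floor ((c * n %% m)%Z * d) (lt0r_neq0 m0).
  have hi := ltz_ceil ((c * n %% m)%Z * d) m0.
  (* The bounds become [r * m <= e * n + r * m < (r + 1) * m]; cancel [r * m]. *)
  move: lo hi; rewrite -rE /modz -qE sE => lo hi.
  by apply/andP; split; lia.
have qE : (c * n %/ m)%Z = q.
  apply: divz_unique => //; apply/andP; split.
    by rewrite -subr_ge0 -(pmulr_lge0 _ d0) sE addr_ge0 // mulr_ge0 // ltW.
  (* Integrality gives [r + 1 <= d], so [s * d < (r + 1) * m <= d * m]. *)
  rewrite -(ltr_pM2r d0); nia.
split=> //; apply/esym/divz_unique => //.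
by rewrite /modz qE sE; lia.
Qed.

Theorem theorem2 (R : realType) (d N c m : int)
    (hd : 0 < d) (hN : d <= N) (hc : 0 <= c) (hm : 0 < m) :
  (forall n : int, 0 <= n <= N ->
     divR (n%:~R : R) d%:~R = divR ((c * n)%:~R : R) m%:~R /\
     remR (n%:~R : R) d%:~R =
       (divR (remR ((c * n)%:~R : R) m%:~R * d%:~R) m%:~R)%:~R)
  <->
  (1 / d%:~R <= c%:~R / m%:~R :> R) /\
  (c%:~R / m%:~R < (1 + 1 / N%:~R) * (1 / d%:~R) :> R).
Proof.
have N0 : 0 < N by apply: lt_le_trans hN.
have dR : 0 < d%:~R :> R by rewrite ltr0z.
have mR : 0 < m%:~R :> R by rewrite ltr0z.
have NR : 0 < N%:~R :> R by rewrite ltr0z.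
have -> : (1 / d%:~R <= c%:~R / m%:~R :> R) = (m <= c * d).
  by rewrite ler_pdivrMr // mulrAC ler_pdivlMr // mul1r -intrM ler_int.
(* This is [e * N < m], since [(N + 1) * m - c * d * N = m - e * N]. *)
have -> : (c%:~R / m%:~R < (1 + 1 / N%:~R) * (1 / d%:~R) :> R)
          = (c * d * N < (N + 1) * m).
  have -> : (1 + 1 / N%:~R) * (1 / d%:~R) = (N + 1)%:~R / (d * N)%:~R :> R.
    by rewrite intrD intrM; field; rewrite !gt_eqF.
  rewrite ltr_pdivrMr // mulrAC ltr_pdivlMr ?ltr0z ?mulr_gt0 //.
  by rewrite -!intrM ltr_int mulrA.
have pointwise n : divR (n%:~R : R) d%:~R = divR ((c * n)%:~R : R) m%:~R /\
    remR (n%:~R : R) d%:~R =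
      (divR (remR ((c * n)%:~R : R) m%:~R * d%:~R) m%:~R)%:~R
    <-> 0 <= (c * d - m) * n < m.
  rewrite !remR_intE // -intrM !divR_intE // -div_rem_approxP //.
  (* The remainder equation lives in [R]; injectivity of the cast brings it back to [int]. *)
  by split=> -[-> rE]; split=> //; [apply: (@intr_inj R) | rewrite rE].
split=> [H|[lo hi] n /andP[n0 nN]].
  (* As [N > 0], [0 <= e * N] yields [0 <= e], that is [m <= c * d]. *)
  have /pointwise/andP[lo hi] := H N (introT andP (conj (ltW N0) (lexx N))).
  by split; [rewrite -subr_ge0 -(pmulr_lge0 _ N0) | lia].
apply/pointwise; rewrite mulr_ge0 ?subr_ge0 //=.
(* Since [0 <= e], the product [e * n] is largest at [n = N]. *)
by apply: (@le_lt_trans _ _ ((c * d - m) * N)); [rewrite ler_wpM2l ?subr_ge0|lia].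
Qed.
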